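(* Consider the $\mathrm{Lip}_1$-pay-as-bid auction game with set of producers $\mathcal N$, production cost functions $C_i$ ($i\in\mathcal N$), and demand function $D$. For every strategy profile $S\in(\mathrm{Lip}_1)^{\mathcal N}$ and every producer $i\in\mathcal N$, if $S_i\in\mathcal B_i(S_{-i})$ is a best response of producer $i$, then there exists an activation price $x_i\in[0,\hat p]$ such that $$S_i(p)=[p-x_i]_+\,,\qquad\forall p\in[0,p^*],$$ where $p^*=p^*(S)$ is the market-clearing price of $S$.
   Context: Notation: $\mathbb R_+=[0,\infty)$, $[t]_+=\max\{t,0\}$. Market: $\mathcal N=\{1,\dots,n\}$ is a non-empty finite set of producers. Each production cost function $C_i:\mathbb R_+\to\mathbb R_+$ is twice continuously differentiable, non-decreasing and convex. The demand function $D:\mathbb R_+\to\mathbb R$ is twice continuously differentiable, strictly decreasing, with $D(0)>0$, $\hat p:=\sup\{p\ge 0: D(p)>0\}<+\infty$, and $D$ concave on $[0,\hat p]$. $\mathrm{Lip}_1$ is the set of non-decreasing functions $F:[0,\hat p]\to\mathbb R_+$ with $F(0)=0$ and $|F(x)-F(y)|\le|x-y|$ for all $x,y\in[0,\hat p]$. The $\mathrm{Lip}_1$-pay-as-bid auction game is the strategic game with player set $\mathcal N$, where each player $i$ chooses a supply function $S_i\in\mathrm{Lip}_1$. Given $S=(S_1,\dots,S_n)$, the market-clearing price $p^*(S)$ is the unique $p^*\in[0,\hat p]$ with $D(p^* )=\sum_{i=1}^n S_i(p^* )$, and the utility of player $i$ is $$u_i(S)=p^*S_i(p^* )-\int_0^{p^*}S_i(p)\,dp-C_i(S_i(p^*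 )),\qquad p^*=p^*(S).$$ The best response of $i$ to $S_{-i}$ is $\mathcal B_i(S_{-i})=\operatorname{argmax}_{S_i\in\mathrm{Lip}_1}u_i(S_i,S_{-i})$. *)

(* Defs.v *)
From mathcomp Require Export all_boot all_order all_algebra.
From mathcomp Require Export all_classical all_reals all_analysis.
Export Order.TTheory GRing.Theory Num.Theory.
Export numFieldNormedType.Exports.

Set Implicit Arguments.
Unset Strict Implicit.
Unset Printing Implicit Defensive.

Local Open Scope classical_set_scope.
Local Open Scope ring_scope.

(* Functions on [0, +oo[ or [0, phat] are represented by total functions
   R -> R; every hypothesis below, as well as the clearing price and the
   utilities, only depends on the values taken on the intended domain. *)

(* Two-sided derivative at x > 0, right derivative at x = 0. *)
Definition derives_on_Rplus (R : realType) (f f' : R -> R) : Prop :=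
  forall x : R, 0 <= x ->
    (f y - f x) / (y - x) @[y --> within `[0, +oo[ x^'] --> f' x.

Definition C2_on_Rplus (R : realType) (f : R -> R) : Prop :=
  exists f' f'' : R -> R,
    [/\ derives_on_Rplus f f', derives_on_Rplus f' f''
      & {within `[0, +oo[, continuous f''}].

Definition cost_function (R : realType) (C : R -> R) : Prop :=
  [/\ forall x, 0 <= x -> 0 <= C x,
      C2_on_Rplus C,
      {in `[0, +oo[ &, {homo C : x y / x <= y}}
    & convex_function (`[0, +oo[ : set R^o) (C : R^o -> R^o)].

Definition price_cap (R : realType) (D : R -> R) : R :=
  sup [set p | 0 <= p /\ 0 < D p].

(* [has_ubound] is the finiteness of the supremum [price_cap D]: [sup] has a
   default value on unbounded sets. *)
Definition demand_function (R : realType) (D : R -> R) : Prop :=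
  [/\ C2_on_Rplus D,
      {in `[0, +oo[ &, {homo D : x y /~ x < y}},
      0 < D 0,
      has_ubound [set p | 0 <= p /\ 0 < D p]
    & convex_function (`[0, price_cap D] : set R^o) (\- D : R^o -> R^o)].

Definition Lip1 (R : realType) (phat : R) : set (R -> R) :=
  [set F | [/\ {in `[0, phat], forall x, 0 <= F x},
               {in `[0, phat] &, {homo F : x y / x <= y}},
               F 0 = 0
             & {in `[0, phat] &, forall x y, `|F x - F y| <= `|x - y|}]].

Definition market_clears (R : realType) (n : nat) (D : R -> R)
    (S : 'I_n -> R -> R) : set R :=
  [set p | p \in `[0, price_cap D] /\ D p = \sum_(i < n) S i p].

(* [get A] is a chosen element of A; existence and uniqueness of the clearing
   price are [clearing_priceP] and [clearing_price_unique] below. *)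
Definition clearing_price (R : realType) (n : nat) (D : R -> R)
    (S : 'I_n -> R -> R) : R :=
  get (market_clears D S).

Lemma continuous_on_Rplus (R : realType) (f f' : R -> R) :
  derives_on_Rplus f f' -> {within `[0, +oo[, continuous f}.
Proof.
move=> df; apply/subspace_continuousP => x /= x0; have {x0} x_ge0 : 0 <= x.
  by move: x0; rewrite in_itv/= andbT.
have h : (f y - f x) / (y - x) * (y - x) @[y --> within `[0, +oo[ x^'] --> (0 : R).
  rewrite -[X in _ --> X](mulr0 (f' x)); apply: cvgM; first exact: df.
  rewrite -[X in _ --> X](subrr x); apply: cvgB; last exact: cvg_cst.
  apply: cvg_within_filter; apply: cvg_trans; last exact: cvg_id.
  exact: nbhs_dnbhs.
apply/cvgrPdist_lt => e e0.
move/cvgrPdist_lt : h => /(_ e e0) [d /= d0 h]; exists d => //= y xy y0.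
have [->|yx] := eqVneq y x; first by rewrite subrr normr0.
have := h y xy yx y0.
by rewrite divfK ?subr_eq0// sub0r normrN distrC.
Qed.

Lemma clearing_price_unique (R : realType) (n : nat) (D : R -> R)
    (S : 'I_n -> R -> R) (p q : R) :
  demand_function D -> (forall j, Lip1 (price_cap D) (S j)) ->
  market_clears D S p -> market_clears D S q -> p = q.
Proof.
move=> hD hS; case: hD => _ Ddecr _ _ _.
wlog pq : p q / p < q => [wl [? ?] [? ?]|].
  by have [pq|pq|//] := ltgtP p q; [|symmetry]; apply: wl.
move=> [pI Dp] [qI Dq]; suff : D p <= D q.
  rewrite leNgt Ddecr ?in_itv/= ?andbT//.
    by move: qI; rewrite in_itv/= => /andP[].
  by move: pI; rewrite in_itv/= => /andP[].
rewrite Dp Dq; apply: ler_sum => i _.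
by case: (hS i) => _ + _ _; apply => //; exact: ltW.
Qed.

Lemma clearing_priceP (R : realType) (n : nat) (D : R -> R)
    (S : 'I_n -> R -> R) :
  demand_function D -> (forall j, Lip1 (price_cap D) (S j)) ->
  market_clears D S (clearing_price D S).
Proof.
move=> hD hS; case: hD => [[D' [_ [/continuous_on_Rplus Dcont _ _]]]] Ddecr D0 Dub _.
have hE : has_sup [set p : R | 0 <= p /\ 0 < D p] by split => //; exists 0; split.
have cap0 : 0 <= price_cap D.
  by apply: ub_le_sup => //; split.
have Dcap : D (price_cap D) <= 0.
  rewrite leNgt; apply/negP => Dc.
  move/subspace_continuousP : Dcont => /(_ (price_cap D)) /=.
  rewrite in_itv/= andbT => /(_ cap0) /cvgrPdist_lt /(_ _ Dc) /=.
  rewrite /prop_near1 /within/= => -[d /= d0 /(_ (price_cap D + d / 2))] /=.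
  have d20 : 0 < d / 2 by rewrite divr_gt0.
  rewrite opprD addNKr normrN gtr0_norm// ltr_pdivrMr// ltr_pMr// ltr1n.
  move=> /(_ isT); rewrite in_itv/= andbT addr_ge0// 1?ltW// => /(_ isT) h.
  suff : price_cap D + d / 2 <= price_cap D by rewrite gerDl leNgt d20.
  apply: ub_le_sup => //; split; first by rewrite addr_ge0// ltW.
  by move: h; rewrite ltr_norml => /andP[_]; rewrite ltrBlDr ltrDl.
have S0 (p : R) : p \in `[0, price_cap D] -> 0 <= \sum_(i < n) S i p.
  by move=> pI; apply: sumr_ge0 => i _; case: (hS i) => + _ _ _; apply.
have Scont i : {within `[0, price_cap D], continuous (S i)}.
  apply/subspace_continuousP => x xI; apply/cvgrPdist_lt => e e0.
  rewrite /prop_near1 /within/=; exists e => //= y xy yI.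
  by case: (hS i) => _ _ _ /(_ x y xI yI) /le_lt_trans; apply.
have [p pI] : exists2 p, p \in `[0, price_cap D] & D p - \sum_(i < n) S i p = 0.
  apply: IVT => //.
    apply: (@within_continuousB _ _ _ _ D) => //.
      apply: continuous_subspaceW Dcont => x /=; rewrite !in_itv/= andbT.
      by case/andP.
    move=> x; apply: cvg_big => [|i _]; last exact: Scont.
    by move=> [a b] /=; apply: cvgD; [exact: cvg_fst|exact: cvg_snd].
  rewrite ge_min le_max; apply/andP; split; apply/orP; [right|left].
    by rewrite subr_le0 (le_trans Dcap)// S0// in_itv/= cap0 lexx.
  by rewrite big1 ?subr0 ?ltW// => i _; case: (hS i).
move=> /eqP; rewrite subr_eq0 => /eqP DS.
by apply: getPex; exists p.
Qed.

Definition utility (R : realType) (n : nat) (C : 'I_n -> R -> R) (D : R -> R)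
    (S : 'I_n -> R -> R) (i : 'I_n) : R :=
  let p := clearing_price D S in
  p * S i p - \int[lebesgue_measure]_(q in `[0, p]) S i q - C i (S i p).

(* The component S i of S is overwritten, so this set depends only on S_{-i}. *)
Definition best_response (R : realType) (n : nat) (C : 'I_n -> R -> R)
    (D : R -> R) (S : 'I_n -> R -> R) (i : 'I_n) : set (R -> R) :=
  [set F | Lip1 (price_cap D) F /\
           forall G, Lip1 (price_cap D) G ->
             utility C D [eta S with i |-> G] i
               <= utility C D [eta S with i |-> F] i].

(* Main.v *)
Require Import Defs.
From mathcomp Require Import lra.

Set Implicit Arguments.
Unset Strict Implicit.
Unset Printing Implicit Defensive.

Local Open Scope classical_set_scope.
Local Open Scope ring_scope.

(** Let [p] be the clearing price, [q := S i p] the quantity sold by producer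
    [i], and [x := p - q].  Since [S i] is 1-Lipschitz and non-negative, it
    dominates [G t := max (t - x) 0] on [0, p] ([Lip1_ge_ramp]), and [G p = q].
    Thus, on [0, p], [G] is the smallest admissible supply function through the
    point [(p, q)].  If [i] deviates to [G], the market still clears at [p] and [i]
    sells the same quantity at the same cost, so the utility changes only
    through the integral term ([best_response_le_Rintegral]).  Optimality of
    [S i] therefore gives that the integral of [S i] over [0, p] is at most
    that of [G]; as [S i - G] is continuous and non-negative, it vanishes on
    [0, p] ([continuous_Rintegral_le0_eq0]). *)

Lemma subset_Rintegral d (T : measurableType d) (R : realType)
    (mu : {measure set T -> \bar R}) (A B : set T) (f : T -> R) :
  measurable A -> measurable B -> A `<=` B ->
  mu.-integrable B (EFin \o f) -> (forall x, B x -> 0 <= f x) ->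
  \int[mu]_(x in A) f x <= \int[mu]_(x in B) f x.
Proof.
move=> mA mB AB fi f0.
rewrite -[X in _ <= Rintegral _ X _](setDUK AB) Rintegral_setU ?setDUK//.
- by rewrite lerDl Rintegral_ge0// => x [Bx _]; exact: f0.
- exact: measurableD.
- by apply/disj_setPS => x [Ax [_ /(_ Ax)]].
Qed.

Lemma continuous_Rintegral_le0_eq0 (R : realType) (a b : R) (f : R -> R) :
  a < b -> {within `[a, b], continuous f} ->
  {in `[a, b], forall x, 0 <= f x} ->
  \int[lebesgue_measure]_(x in `[a, b]) f x <= 0 ->
  {in `[a, b], forall x, f x = 0}.
Proof.
move=> ab fc f0 If t tab; apply/eqP/negPn/negP => ft0.
have ft : 0 < f t by rewrite lt_neqAle eq_sym ft0 f0.
have fi := continuous_compact_integrable (segment_compact (a := a) (b := b)) fc.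
have e0 : 0 < f t / 2 by lra.
move/subspace_continuousP : fc => /(_ t tab) /cvgrPdist_lt /(_ _ e0).
rewrite /prop_near1 /within/= => -[d /= d0 fd].
have {}fd (y : R) : `|t - y| < d -> y \in `[a, b] -> `|f t - f y| < f t / 2.
  exact: fd.
move: (tab); rewrite in_itv/= => /andP[at_ tb].
(* A non-degenerate interval around [t], inside [a, b], where f > f t / 2. *)
pose l := Num.max a (t - d / 2); pose u := Num.min b (t + d / 2).
have [al tl lt] : [/\ a <= l, t - d / 2 <= l & l <= t].
  by rewrite /l; split; rewrite ?le_max ?ge_max ?lexx ?orbT//; lra.
have [ub ut tu] : [/\ u <= b, u <= t + d / 2 & t <= u].
  by rewrite /u; split; rewrite ?ge_min ?le_min ?lexx ?orbT//; lra.
have lu : l < u by rewrite /l /u lt_min !gt_max; lra.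
have sub : `[l, u] `<=` `[a, b].
  by move=> y /=; rewrite !in_itv/= => /andP[? ?]; apply/andP; split; lra.
have f_ge (y : R) : y \in `[l, u] -> f t / 2 <= f y.
  move=> ylu; have := fd y; rewrite ltr_norml => /(_ _ (sub _ ylu)).
  move: ylu; rewrite in_itv/= => /andP[ly yu] fty.
  have /fty : - d < t - y < d by apply/andP; split; lra.
  by rewrite ltr_norml => /andP[? ?]; lra.
have : 0 < \int[lebesgue_measure]_(x in `[l, u]) f x.
  apply: (@lt_le_trans _ _ (\int[lebesgue_measure]_(x in `[l, u]) (f t / 2))).
    rewrite Rintegral_cst//= mulr_gt0// lebesgue_measure_itv/= lte_fin lu/=.
    by rewrite subr_gt0.
  apply: le_Rintegral => //.
  - apply: continuous_compact_integrable; first exact: segment_compact.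
    by move=> x; exact: cvg_cst.
  - exact: integrableS fi.
by rewrite ltNge (le_trans _ If)//; apply: subset_Rintegral => //; exact: f0.
Qed.

Lemma Lip1_continuous (R : realType) (c : R) (F : R -> R) :
  Lip1 c F -> {within `[0, c], continuous F}.
Proof.
move=> [_ _ _ Flip]; apply/subspace_continuousP => x xI.
apply/cvgrPdist_lt => e e0; rewrite /prop_near1 /within/=.
by exists e => //= y xy yI; apply: le_lt_trans (Flip x y xI yI) _.
Qed.

Lemma Lip1_ramp (R : realType) (c x : R) :
  0 <= x -> Lip1 c (fun t => Num.max (t - x) 0).
Proof.
move=> x0; split.
- by move=> t _; rewrite le_max lexx orbT.
- by move=> s t _ _ st; rewrite ge_max !le_max lerB// lexx orbT.
- by rewrite max_r// sub0r oppr_le0.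
- move=> s t _ _; rewrite ler_norml.
  by case: (leP (s - x) 0) => ?; case: (leP (t - x) 0) => ?;
    case: (ger0P (s - t)) => ?; apply/andP; split; lra.
Qed.

(** Going backwards from [p], a 1-Lipschitz function decreases at rate at most
    one, so it lies above the line of slope one through [(p, F p)]. *)
Lemma Lip1_ge_ramp (R : realType) (c p t : R) (F : R -> R) :
  Lip1 c F -> 0 <= t -> t <= p -> p <= c ->
  Num.max (t - (p - F p)) 0 <= F t.
Proof.
move=> [F0 _ _ Flip] t0 tp pc.
have tI : t \in `[0, c] by rewrite in_itv/= t0 (le_trans tp pc).
have pI : p \in `[0, c] by rewrite in_itv/= (le_trans t0 tp) pc.
rewrite ge_max F0// andbT; have := Flip p t pI tI.
rewrite (ger0_norm (_ : 0 <= p - t)) ?subr_ge0// ler_norml => /andP[_].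
lra.
Qed.

Lemma clearing_price_deviation (R : realType) (n : nat) (D : R -> R)
    (S : 'I_n -> R -> R) (i : 'I_n) (G : R -> R) :
  demand_function D -> (forall j, Lip1 (price_cap D) (S j)) ->
  Lip1 (price_cap D) G ->
  G (clearing_price D S) = S i (clearing_price D S) ->
  clearing_price D [eta S with i |-> G] = clearing_price D S.
Proof.
move=> D_demand S_Lip1 G_Lip1 GS.
have dev_Lip1 j : Lip1 (price_cap D) ([eta S with i |-> G] j).
  by rewrite /=; case: eqP.
apply: (clearing_price_unique D_demand dev_Lip1).
  exact: clearing_priceP.
have [pI Dp] := clearing_priceP D_demand S_Lip1; split => //.
by rewrite Dp; apply: eq_bigr => j _ /=; case: eqP => // ->.
Qed.

(** A deviation [G] of producer [i] that agrees with [S i] at the clearing price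
    leaves price, quantity and cost unchanged; only the pay-as-bid discount, the
    integral of the supply function, can differ. *)
Lemma best_response_le_Rintegral (R : realType) (n : nat) (C : 'I_n -> R -> R)
    (D : R -> R) (S : 'I_n -> R -> R) (i : 'I_n) (G : R -> R) :
  demand_function D -> (forall j, Lip1 (price_cap D) (S j)) ->
  Lip1 (price_cap D) G ->
  G (clearing_price D S) = S i (clearing_price D S) ->
  best_response C D S i (S i) ->
  \int[lebesgue_measure]_(t in `[0, clearing_price D S]) S i t <=
  \int[lebesgue_measure]_(t in `[0, clearing_price D S]) G t.
Proof.
move=> D_demand S_Lip1 G_Lip1 GS [_ /(_ _ G_Lip1)].
have -> : ([eta S with i |-> S i] : 'I_n -> R -> R) = S.
  by apply/funext => j /=; case: eqP => // ->.
rewrite /utility clearing_price_deviation//= eqxx GS.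
by rewrite lerD2r lerD2l lerN2.
Qed.

Theorem proposition3 (R : realType) (n : nat) (n_gt0 : (0 < n)%N)
    (C : 'I_n -> R -> R) (D : R -> R)
    (C_cost : forall i, cost_function (C i)) (D_demand : demand_function D)
    (S : 'I_n -> R -> R) (S_Lip1 : forall j, Lip1 (price_cap D) (S j))
    (i : 'I_n) (S_br : best_response C D S i (S i)) :
  exists2 x : R, x \in `[0, price_cap D] &
    {in `[0, clearing_price D S], forall p, S i p = Num.max (p - x) 0}.
Proof.
have [] := clearing_priceP D_demand S_Lip1.
set p := clearing_price D S; rewrite in_itv/= => /andP[p0 pc] _.
have Si := S_Lip1 i; have [Si0 _ S0 _] := Si.
have q0 : 0 <= S i p by apply: Si0; rewrite in_itv/= p0 pc.
have x0 : 0 <= p - S i p.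
  have := Lip1_ge_ramp Si (lexx 0) p0 pc.
  by rewrite S0 ge_max => /andP[+ _]; rewrite sub0r oppr_le0.
exists (p - S i p); first by rewrite in_itv/= x0; lra.
pose G t := Num.max (t - (p - S i p)) 0.
have GL : Lip1 (price_cap D) G by exact: Lip1_ramp.
have Gp : G p = S i p by rewrite /G subKr max_l.
(* For p = 0 the interval is a single point, on which G agrees with S i. *)
have [p_gt0|p_le0] := ltP 0 p; last first.
  move=> t; rewrite in_itv/= => /andP[t0 tp].
  have -> : t = p by lra.
  by rewrite -[RHS]/(G p) Gp.
have cont F : Lip1 (price_cap D) F -> {within `[0, p], continuous F}.
  move=> /Lip1_continuous; apply: continuous_subspaceW => t /=.
  by rewrite !in_itv/= => /andP[-> /le_trans ->].
have intg F : Lip1 (price_cap D) F ->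
    lebesgue_measure.-integrable `[0, p] (EFin \o F).
  by move=> /cont; apply: continuous_compact_integrable; exact: segment_compact.
move=> t tI; apply/eqP; rewrite -subr_eq0; apply/eqP.
apply: (@continuous_Rintegral_le0_eq0 _ 0 p (fun t => S i t - G t)) tI => //.
- by move=> y; apply: (@continuousB _ _ (subspace `[0, p])); apply: cont.
- move=> y; rewrite in_itv/= => /andP[y0 yp].
  by rewrite subr_ge0; exact: (Lip1_ge_ramp Si y0 yp pc).
rewrite RintegralB//; try exact: intg.
by rewrite subr_le0 (best_response_le_Rintegral D_demand S_Lip1 GL Gp S_br).
Qed.
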